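(* Let $\beta>0$. There exists a constant $C>0$, independent of $n$ and $m$, such that the following holds for every $m$. Let $f_{\mathrm{vMF}}(x;\alpha,\beta)$ be the von Mises-Fisher density on the unit $m$-sphere $\mathbb S^m$ and define the minimax risk $$\mathcal R_{n,\mathrm{vMF}}(\beta)=\inf_{\hat\alpha}\sup_{\alpha\in\mathbb S^m}\mathbb E\big[d_g(\hat\alpha(x_1,\dots,x_n),\alpha)\big],$$ where the infimum is over all estimators (measurable maps $\hat\alpha:(\mathbb S^m)^n\to\mathbb S^m$) and the expectation is over independent samples $x_1,\dots,x_n$ drawn from $f_{\mathrm{vMF}}(\cdot;\alpha,\beta)$. Then for sufficiently large $n$, $$\mathcal R_{n,\mathrm{vMF}}(\beta)\ge Cmn^{-1/2}.$$
   Context: $d_g$ is the geodesic distance and $\mathrm{dvol}$ the Riemannian volume measure on the unit sphere $\mathbb S^m$. The von Mises-Fisher density is $f_{\mathrm{vMF}}(x;\alpha,\beta)=\frac{1}{Z_{\mathrm{vMF}}(\beta)}e^{\beta\cos d_g(x,\alpha)}$, $Z_{\mathrm{vMF}}(\beta)=\int_{\mathbb S^m}e^{\beta\cos d_g(x,\alpha)}\,\mathrm{dvol}(x)$, with $\alpha\in\mathbb S^m$ and known $\beta>0$. ''Sufficiently large $n$'' means $n\ge n_0$ for a threshold $n_0$ that may depend on the other parameters (including $m$). *)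

(* Defs.v *)
From HB Require Import structures.
From mathcomp Require Import all_boot all_order all_algebra.
From mathcomp Require Import all_classical all_reals all_analysis.
From mathcomp Require Import ring.

Set Implicit Arguments.
Unset Strict Implicit.
Unset Printing Implicit Defensive.

Import Order.TTheory GRing.Theory Num.Theory.
Import numFieldNormedType.Exports.

Local Open Scope classical_set_scope.
Local Open Scope ring_scope.

(* Integrals, products and pushforwards are defined for arbitrary set
   functions, so the measures below are given by their values on sets. *)

Section product_measure.
Context d (T : measurableType d) (R : realType).
Local Open Scope ereal_scope.

(* The n-fold product of mu on T^n; for mu the law of one observation, the law
   of n independent observations. *)
Fixpoint tuple_measure (mu : set T -> \bar R) (n : nat) :
    set (n.-tuple T) -> \bar R :=
  match n return set (n.-tuple T) -> \bar R with
  | 0%N => fun A => \d_([tuple] : 0.-tuple T) A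
  | k.+1 => pushforward (mu \x @tuple_measure mu k)
              (fun p : T * k.-tuple T => [tuple of p.1 :: p.2])
  end.

End product_measure.
Arguments tuple_measure {d T R} mu n.

Definition dotp (R : realType) (n : nat) (x y : 'rV[R]_n) : R :=
  \sum_(i < n) x 0 i * y 0 i.

Section sphere.
Context (R : realType) (m : nat).

Definition sphere := {x : 'rV[R]_m.+1 | dotp x x == 1}.

HB.instance Definition _ := SubType.on sphere.
HB.instance Definition _ := [Choice of sphere by <:].

Fact sphere_pole : dotp (delta_mx 0 0 : 'rV[R]_m.+1) (delta_mx 0 0) == 1.
Proof.
rewrite /dotp (bigD1 ord0)//= big1 ?addr0 => [|i i0]; rewrite !mxE/= ?mulr1//.
by rewrite (negbTE i0) mulr0.
Qed.

HB.instance Definition _ := isPointed.Build sphere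
  (exist (fun x => is_true (dotp x x == 1)) _ sphere_pole).

Definition sphere_coord (x : sphere) : m.+1.-tuple (measurableTypeR R) :=
  [tuple val x 0 i | i < m.+1].

(* The Borel sigma-algebra of the sphere, i.e. the trace of that of R^(m+1). *)
HB.instance Definition _ :=
  Measurable.copy sphere (g_sigma_algebra_preimageType sphere_coord).

(* Length of the shortest great-circle arc from x to y. *)
Definition geodesic_dist (x y : sphere) : R := acos (dotp (val x) (val y)).

(* Inverse stereographic projection from the pole (1, 0, ..., 0), a global
   parametrization of the sphere minus that pole. *)
Definition stereo (u : 'rV[R]_m) : 'rV[R]_m.+1 :=
  row_mx (((dotp u u - 1) / (1 + dotp u u))%:M : 'rV[R]_1)
         ((2 / (1 + dotp u u)) *: u).

Fact stereo0 u : stereo u 0 ord0 = (dotp u u - 1) / (1 + dotp u u).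
Proof.
rewrite (_ : ord0 = lshift m (ord0 : 'I_1)); last exact: val_inj.
by rewrite /stereo (@row_mxEl _ 1 1 m) mxE eqxx mulr1n.
Qed.

Fact stereoS u i : stereo u 0 (lift ord0 i) = 2 / (1 + dotp u u) * u 0 i.
Proof.
rewrite (_ : lift ord0 i = rshift 1 i); last exact: val_inj.
by rewrite /stereo (@row_mxEr _ 1 1 m) mxE.
Qed.

Fact stereo_sphere u : dotp (stereo u) (stereo u) == 1.
Proof.
rewrite {1}/dotp big_ord_recl stereo0.
under eq_bigr do rewrite stereoS mulrACA.
rewrite -mulr_sumr -/(dotp u u).
have s0 : 1 + dotp u u != 0.
  by rewrite gt_eqF// ltr_pwDl//; apply: sumr_ge0 => i _; rewrite -expr2 sqr_ge0.
by apply/eqP; field.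
Qed.

Definition chart (u : m.-tuple (measurableTypeR R)) : sphere :=
  exist _ (stereo (\row_i tnth u i)) (stereo_sphere _).

(* The metric induced by R^(m+1), in the coordinates u: since v *m 'J f u is
   the derivative of f at u along v, the entry (i, j) is <d_i f, d_j f>. *)
Definition metric_tensor (u : 'rV[R]_m) : 'M[R]_m :=
  'J stereo u *m ('J stereo u)^T.

(* dvol = sqrt (det g) du_1 ... du_m, transported by the chart; for 0 < m the
   omitted pole is negligible. *)
Definition dvol : set sphere -> \bar R :=
  pushforward (fun A => \int[tuple_measure lebesgue_measure m]_(u in A)
    (Num.sqrt (\det (metric_tensor (\row_i tnth u i))))%:E)%E chart.

(* By rotation invariance of dvol, Z_vMF does not depend on alpha. *)
Definition Z_vMF (beta : R) (alpha : sphere) : R :=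
  fine (\int[dvol]_x (expR (beta * cos (geodesic_dist x alpha)))%:E)%E.

Definition f_vMF (beta : R) (alpha x : sphere) : R :=
  (Z_vMF beta alpha)^-1 * expR (beta * cos (geodesic_dist x alpha)).

Definition vMF (beta : R) (alpha : sphere) : set sphere -> \bar R :=
  (fun A => \int[dvol]_(x in A) (f_vMF beta alpha x)%:E)%E.

Definition expected_loss (beta : R) (n : nat)
    (ahat : n.-tuple sphere -> sphere) (alpha : sphere) : \bar R :=
  (\int[tuple_measure (vMF beta alpha) n]_x
     (geodesic_dist (ahat x) alpha)%:E)%E.

Definition minimax_risk (beta : R) (n : nat) : \bar R :=
  ereal_inf [set ereal_sup (range (expected_loss beta ahat)) |
             ahat in [set ahat : n.-tuple sphere -> sphere |
                      measurable_fun [set: n.-tuple sphere] ahat]].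

End sphere.

Arguments minimax_risk {R} m beta n.

(* Main.v *)
From HB Require Import structures.
Require Import Defs.
From mathcomp Require Import all_boot all_order all_algebra.
From mathcomp Require Import all_classical all_reals all_analysis.
From mathcomp Require Import measurable_realfun ring lra.

Set Implicit Arguments.
Unset Strict Implicit.
Unset Printing Implicit Defensive.

Import Order.TTheory GRing.Theory Num.Theory.
Import numFieldNormedType.Exports.

Local Open Scope classical_set_scope.
Local Open Scope ring_scope.

(** The lower bound is Assouad's hypercube argument. For [v] a sign vector of
    length m, let [alpha_v] be the point of the sphere near the pole whose m
    tangential coordinates are [+- delta], with [delta] of order [sqrt (m / n)].
    The geodesic distance dominates the chord, and the chord dominates
    [delta / sqrt m] times the number of tangential coordinates of the estimate
    that have the wrong sign ([sign_error_loss]). The supremum of the risk is at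
    least its average over the [2 ^ m] vertices, and in that average the errors on
    a given coordinate pair up into two-point testing problems between the
    n-fold products at [alpha_v] and at its neighbour ([sum_sign_error]). If a
    fixed fraction of these tests is hard, the risk is at least of order
    [delta / sqrt m * m = delta * sqrt m], that is [m / sqrt n].

    The hardness of a test is measured by the Hellinger affinity, which
    multiplies over independent observations ([two_point_error_affinity]). The two
    densities at neighbouring vertices are proportional to [expR (a + t)] and
    [expR (a - t)], with [t = +- beta * delta * x_i]. The affinity of such a pair
    is at least [1 / (1 + K_i)], where [K_i] is of order
    [(beta * delta)^2] times the mean of [x_i^2] ([tilt_normalizers]). The means
    of the [x_i^2] add up to at most 1, because the points have norm 1, so
    [n] times the sum of the [K_i] is of order [n * delta^2], a small multiple of
    m ([sum_coord_cost]): the average test is hard. The only geometric input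
    is that [dvol] is a finite nonzero measure.

    This follows from its density in the stereographic chart: the metric tensor is
    a scalar matrix ([metric_tensor_stereo]), so the density is
    [(2 / (1 + |u|^2)) ^ m]; it lies below a product of Lorentzian profiles and
    above a positive constant on the unit cube. *)

(** * Measures with a density *)

(** Monotonicity for arbitrary nonnegative functions: the integral is a supremum
    over the simple functions below the integrand. In particular it bounds the geodesic
    loss from below by a simple function. *)
Lemma integral_mono (R : realType) d (T : measurableType d)
    (mu : {measure set T -> \bar R}) (f g : T -> \bar R) :
  (forall x, 0 <= f x)%E -> (forall x, f x <= g x)%E ->
  (\int[mu]_x f x <= \int[mu]_x g x)%E.
Proof.
move=> f0 fg; have g0 x : (0 <= g x)%E by rewrite (le_trans (f0 x)).
rewrite !ge0_integralTE//; apply: le_ereal_sup => _ [h hf <-].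
by exists h => // x; rewrite (le_trans (hf x)).
Qed.

Section density.
Context d (T : measurableType d) (R : realType).
Variables (mu P : {measure set T -> \bar R}) (p : T -> R).
Hypothesis p0 : forall x, 0 <= p x.
Hypothesis mp : measurable_fun setT p.
Hypothesis Pp : forall A, measurable A -> P A = (\int[mu]_(x in A) (p x)%:E)%E.
Local Open Scope ereal_scope.

Import HBNNSimple.

(** By monotone convergence it suffices to check simple functions, for which the
    formula is the definition of the density on level sets. *)
Lemma integral_density (h : T -> \bar R) :
  measurable_fun setT h -> (forall x, 0 <= h x) ->
  \int[P]_x h x = \int[mu]_x (h x * (p x)%:E).
Proof.
move=> mh h0; pose g := nnsfun_approx measurableT mh.
have gh x : (g n x)%:E @[n --> \oo] --> h x.
  by apply: cvg_nnsfun_approx => // y _; exact: h0.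
transitivity (limn (fun n => \int[P]_x (g n x)%:E)).
  rewrite -monotone_convergence//.
  - by apply: eq_integral => x _; apply/esym/cvg_lim => //; exact: gh.
  - by move=> n; exact/measurable_EFinP/measurable_funP.
  - by move=> n x _; rewrite lee_fin.
  - by move=> x _ a b ab; rewrite lee_fin; exact/lefP/nd_nnsfun_approx.
transitivity (limn (fun n => \int[mu]_x ((g n x)%:E * (p x)%:E))); last first.
  rewrite -monotone_convergence//.
  - by apply: eq_integral => x _; apply/cvg_lim => //; exact: cvgeZr (gh x).
  - move=> n; apply: emeasurable_funM; last exact/measurable_EFinP.
    exact/measurable_EFinP/measurable_funP.
  - by move=> n x _; rewrite mule_ge0 ?lee_fin.
  - move=> x _ a b ab; rewrite lee_wpmul2r ?lee_fin//.
    exact/lefP/nd_nnsfun_approx.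
congr (limn _); apply/funext => n.
under eq_integral do rewrite fimfunE -fsumEFin//.
under [RHS]eq_integral => x _.
  rewrite fimfunE -fsumEFin// muleC ge0_mule_fsumr; last first.
    by move=> r; exact: nnfun_muleindic_ge0.
  over.
rewrite ge0_integral_fsum//; last 2 first.
- by move=> r; exact/measurable_EFinP/measurable_funM.
- by move=> r x _; exact: nnfun_muleindic_ge0.
rewrite ge0_integral_fsum//; last 2 first.
- move=> r; apply: emeasurable_funM; first exact/measurable_EFinP.
  exact/measurable_EFinP/measurable_funM.
- by move=> r x _; rewrite mule_ge0 ?lee_fin//; exact: nnfun_muleindic_ge0.
apply: eq_fsbigr => r rg.
have r0 : (0 <= r)%R by move: rg; rewrite inE => -[t _ <-].
have mr : measurable (g n @^-1` [set r]) by [].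
rewrite integralZl_indic_nnsfun// integral_indic// setIT Pp//.
transitivity (\int[mu]_x (r%:E * ((p x)%:E * (\1_(g n @^-1` [set r]) x)%:E))).
  rewrite ge0_integralZl//; last 2 first.
  - apply: emeasurable_funM; exact/measurable_EFinP.
  - by move=> x _; rewrite mule_ge0 ?lee_fin.
  congr (_ * _); rewrite integral_mkcond; apply: eq_integral => x _.
  rewrite patchE indicE; case: ifPn => _; by rewrite ?mule1 ?mule0.
by apply: eq_integral => x _; rewrite EFinM muleCA.
Qed.

End density.

(** * Product measures on tuples *)

Section tuple_measurability.
Context d (T : measurableType d).

Lemma measurable_tuple_cons n :
  measurable_fun setT (fun p : T * n.-tuple T => [tuple of p.1 :: p.2]).
Proof. exact: measurable_cons. Qed.

(** Inverse of the previous map: it carries the exhaustion of a product by sets of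
    finite measure to an exhaustion of the space of tuples. *)
Lemma measurable_tuple_uncons n :
  measurable_fun setT
    (fun t : n.+1.-tuple T => (thead t, [tuple of behead t])).
Proof.
apply: measurable_fun_pair => /=; last exact: measurable_behead.
exact: measurable_tnth.
Qed.

End tuple_measurability.

Section cons_measure.
Context d (T : measurableType d) (R : realType) (n : nat).
Variables (mu : {sigma_finite_measure set T -> \bar R})
          (nu : {sigma_finite_measure set n.-tuple T -> \bar R}).
Local Open Scope ereal_scope.

(** One step of the recursion that defines [tuple_measure], between arbitrary
    sigma-finite measures, so that the induction can carry sigma-finiteness. *)
Definition cons_measure : set (n.+1.-tuple T) -> \bar R :=
  pushforward (mu \x nu) (fun p : T * n.-tuple T => [tuple of p.1 :: p.2]).

Let pushm := measure_function_pushforward__canonical__measure_function_Measure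
  (mu \x nu) (@measurable_tuple_cons _ T n).

HB.instance Definition _ := isMeasure.Build _ _ _ cons_measure
  (measure0 pushm) (measure_ge0 pushm) (@measure_semi_sigma_additive _ _ _ pushm).

Let cons_measure_sigma_finite : sigma_finite setT cons_measure.
Proof.
have /sigma_finiteP[F [FT ndF Foo]] := sigma_finiteT mu.
have /sigma_finiteP[G [GT ndG Goo]] := sigma_finiteT nu.
pose f (t : n.+1.-tuple T) := (thead t, [tuple of behead t]).
exists (fun k => f @^-1` (F k `*` G k)).
  rewrite -preimage_bigcup (_ : \bigcup_k _ = setT) ?preimage_setT//.
  apply/seteqP; split => // -[x t] _.
  have [i _ Fi] : (\bigcup_k F k) x by rewrite -FT.
  have [j _ Gj] : (\bigcup_k G k) t by rewrite -GT.
  exists (maxn i j) => //; split => /=.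
    by move: (x) Fi; exact/subsetPset/ndF/leq_maxl.
  by move: (t) Gj; exact/subsetPset/ndG/leq_maxr.
move=> k; have [mF Fk] := Foo k; have [mG Gk] := Goo k; split.
  rewrite -[X in measurable X]setTI; apply: measurable_tuple_uncons => //.
  exact: measurableX.
rewrite /cons_measure /pushforward (_ : _ @^-1` _ = F k `*` G k).
  by rewrite product_measure1E// lte_mul_pinfty// ge0_fin_numE.
apply/seteqP; split => -[x t]; rewrite /preimage /f/= theadE.
  by rewrite (_ : [tuple of _] = t)//; exact: val_inj.
by rewrite (_ : [tuple of _] = t)//; exact: val_inj.
Qed.

HB.instance Definition _ :=
  Measure_isSigmaFinite.Build _ _ _ cons_measure cons_measure_sigma_finite.

End cons_measure.

Section tuple_measure_theory.
Context d (T : measurableType d) (R : realType).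
Variable mu : {sigma_finite_measure set T -> \bar R}.
Local Open Scope ereal_scope.

(** Existence form: the structure on [tuple_measure mu n] is only available after
    this induction, so the induction hypothesis provides a bundled measure. *)
Lemma tuple_measure_sigma_finite n :
  exists nu : {sigma_finite_measure set n.-tuple T -> \bar R},
    nu = tuple_measure mu n :> (set _ -> _).
Proof.
elim: n => [|n [nu nuE]]; first by exists (\d_([tuple] : 0.-tuple T)).
by exists (cons_measure mu nu); rewrite /= -nuE.
Qed.

Lemma tuple_measure0 n : tuple_measure mu n set0 = 0.
Proof. by have [nu <-] := tuple_measure_sigma_finite n. Qed.

Lemma tuple_measure_ge0 n A : 0 <= tuple_measure mu n A.
Proof. by have [nu <-] := tuple_measure_sigma_finite n. Qed.

Lemma tuple_measure_sigma_additive n : semi_sigma_additive (tuple_measure mu n).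
Proof.
by have [nu <-] := tuple_measure_sigma_finite n; exact: measure_semi_sigma_additive.
Qed.

HB.instance Definition _ n := isMeasure.Build _ _ _ (tuple_measure mu n)
  (tuple_measure0 n) (@tuple_measure_ge0 n) (@tuple_measure_sigma_additive n).

Lemma tuple_measure_sigma_finiteT n : sigma_finite setT (tuple_measure mu n).
Proof.
by have [nu <-] := tuple_measure_sigma_finite n; exact: sigma_finiteT.
Qed.

HB.instance Definition _ n := Measure_isSigmaFinite.Build _ _ _
  (tuple_measure mu n) (tuple_measure_sigma_finiteT n).

Lemma integral_tuple_measure0 (h : 0.-tuple T -> \bar R) :
  (forall t, 0 <= h t) -> measurable_fun setT h ->
  \int[tuple_measure mu 0]_t h t = h [tuple].
Proof. by move=> h0 mh; rewrite /= integral_dirac// diracT mul1e. Qed.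

Lemma integral_tuple_measureS n (h : n.+1.-tuple T -> \bar R) :
  (forall t, 0 <= h t) -> measurable_fun setT h ->
  \int[tuple_measure mu n.+1]_t h t =
  \int[mu]_x \int[tuple_measure mu n]_t h [tuple of x :: t].
Proof.
move=> h0 mh; have mc := @measurable_tuple_cons _ T n.
transitivity (\int[mu \x tuple_measure mu n]_p h [tuple of p.1 :: p.2]).
  transitivity (\int[cons_measure mu (tuple_measure mu n)]_t h t) => //.
  by rewrite /cons_measure (ge0_integral_pushforward mc)// preimage_setT.
by rewrite fubini_tonelli1//; exact: measurableT_comp mh mc.
Qed.

Lemma measurable_prod_tnth n (phi : T -> R) : measurable_fun setT phi ->
  measurable_fun setT (fun t : n.-tuple T => \prod_(i < n) phi (tnth t i))%R.
Proof.
move=> mphi; apply: measurable_prod => i _.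
by apply: measurableT_comp => //; exact: measurable_tnth.
Qed.

Lemma prod_tnth_cons n (phi : T -> R) x (t : n.-tuple T) :
  (\prod_(i < n.+1) phi (tnth [tuple of x :: t] i) =
   phi x * \prod_(i < n) phi (tnth t i))%R.
Proof.
by rewrite big_ord_recl tnth0; congr *%R; apply: eq_bigr => i _; rewrite tnthS.
Qed.

Lemma integral_prod_tnth n (phi : T -> R) : (forall x, 0 <= phi x)%R ->
  measurable_fun setT phi ->
  \int[tuple_measure mu n]_t (\prod_(i < n) phi (tnth t i))%:E =
  (\int[mu]_x (phi x)%:E) ^+ n.
Proof.
move=> phi0 mphi; elim: n => [|n IHn].
  rewrite integral_tuple_measure0//; first by rewrite big_ord0.
    by move=> t; rewrite lee_fin prodr_ge0.
  by apply/measurable_EFinP; exact: measurable_prod_tnth.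
rewrite integral_tuple_measureS//; last 2 first.
- by move=> t; rewrite lee_fin prodr_ge0.
- by apply/measurable_EFinP; exact: measurable_prod_tnth.
under eq_integral => x _.
  under eq_integral do rewrite prod_tnth_cons EFinM.
  rewrite ge0_integralZl ?lee_fin//; last 2 first.
  - by apply/measurable_EFinP; exact: measurable_prod_tnth.
  - by move=> t _; rewrite lee_fin prodr_ge0.
  rewrite IHn; over.
rewrite ge0_integralZr//; last 3 first.
- exact/measurable_EFinP.
- by move=> x _; rewrite lee_fin.
- by rewrite expe_ge0// integral_ge0// => x _; rewrite lee_fin.
by rewrite expeS.
Qed.

End tuple_measure_theory.

Section tuple_density.
Context d (T : measurableType d) (R : realType).
Variables (mu P : {sigma_finite_measure set T -> \bar R}) (p : T -> R).
Hypothesis p0 : forall x, 0 <= p x.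
Hypothesis mp : measurable_fun setT p.
Hypothesis Pp : forall A, measurable A -> P A = (\int[mu]_(x in A) (p x)%:E)%E.
Local Open Scope ereal_scope.

(** Tonelli, one coordinate at a time. *)
Lemma integral_tuple_density n (h : n.-tuple T -> \bar R) :
  measurable_fun setT h -> (forall t, 0 <= h t) ->
  \int[tuple_measure P n]_t h t =
  \int[tuple_measure mu n]_t (h t * (\prod_(i < n) p (tnth t i))%:E).
Proof.
have mpp k := @measurable_prod_tnth _ T R k _ mp.
elim: n h => [|n IHn] h mh h0.
  rewrite !integral_tuple_measure0//; first by rewrite big_ord0 mule1.
    by move=> t; rewrite mule_ge0// lee_fin prodr_ge0.
  by apply: emeasurable_funM mh _; apply/measurable_EFinP; exact: mpp.
have mcx x : measurable_fun setT (fun t : n.-tuple T => [tuple of x :: t]).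
  by apply: measurable_cons => //; exact: measurable_id.
have mhp : measurable_fun setT
    (fun t : n.+1.-tuple T => h t * (\prod_(i < n.+1) p (tnth t i))%:E).
  by apply: emeasurable_funM mh _; apply/measurable_EFinP; exact: mpp.
have mh' : measurable_fun setT (fun y : T * n.-tuple T =>
    h [tuple of y.1 :: y.2] * (\prod_(i < n) p (tnth y.2 i))%:E).
  apply: emeasurable_funM.
    exact: (measurableT_comp mh (@measurable_tuple_cons _ T n)).
  by apply/measurable_EFinP; exact: (measurableT_comp (mpp n) (@measurable_snd _ _ T _)).
rewrite !integral_tuple_measureS//; last first.
  by move=> t; rewrite mule_ge0// lee_fin prodr_ge0.
under eq_integral => x _.
  rewrite IHn//; last exact: measurableT_comp mh (mcx x).
  over.
rewrite (integral_density p0 mp Pp); last 2 first.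
- apply: measurable_fun_fubini_tonelli_F mh' _ => y.
  by rewrite mule_ge0// lee_fin prodr_ge0.
- by move=> x; apply: integral_ge0 => t _; rewrite mule_ge0// lee_fin prodr_ge0.
apply: eq_integral => x _.
rewrite -ge0_integralZr//; last 3 first.
- apply: emeasurable_funM; first exact: measurableT_comp mh (mcx x).
  by apply/measurable_EFinP; exact: mpp.
- by move=> t _; rewrite mule_ge0// lee_fin prodr_ge0.
- by rewrite lee_fin.
apply: eq_integral => t _.
by rewrite prod_tnth_cons EFinM -muleA; congr (_ * _); rewrite muleC.
Qed.

End tuple_density.

(** * Two hypotheses and the Hellinger affinity *)

Lemma ler_amgm2 (R : realFieldType) (a b c : R) :
  0 <= a -> 0 <= b -> c ^+ 2 = a * b -> c *+ 2 <= a + b.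
Proof.
move=> a0 b0 cab; have [c0|c0] := leP c 0.
  by rewrite (le_trans (mulrn_wle0 _ c0))// addr_ge0.
have : (c *+ 2) ^+ 2 <= (a + b) ^+ 2.
  rewrite -mulr_natl exprMn cab -subr_ge0.
  by rewrite (_ : _ - _ = (a - b) ^+ 2) ?sqr_ge0//; ring.
by rewrite ler_sqr// nnegrE addr_ge0// ltW.
Qed.

Section hellinger.
Context d (T : measurableType d) (R : realType).
Variables (mu P Q : {sigma_finite_measure set T -> \bar R}) (p q r : T -> R).
Hypotheses (p0 : forall x, 0 <= p x) (mp : measurable_fun setT p).
Hypotheses (q0 : forall x, 0 <= q x) (mq : measurable_fun setT q).
Hypotheses (r0 : forall x, 0 <= r x) (mr : measurable_fun setT r).
Hypothesis rpq : forall x, r x ^+ 2 = p x * q x.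
Hypothesis Pp : forall A, measurable A -> P A = (\int[mu]_(x in A) (p x)%:E)%E.
Hypothesis Qq : forall A, measurable A -> Q A = (\int[mu]_(x in A) (q x)%:E)%E.
Hypotheses (P1 : P setT = 1%E) (Q1 : Q setT = 1%E).
Local Open Scope ereal_scope.

(** Le Cam's bound: a test cannot have both errors small when the Hellinger
    affinity [rho] of one observation is close to 1, since affinities multiply
    over independent observations. By AM-GM the root of the product density is at
    most [p^n / A + (A / 4) q^n], and symmetrically; the first form is integrated
    over [E], the second over its complement, and in both the term with the small
    weight [A / 4] is bounded by a total mass. *)
Lemma two_point_error_affinity (rho : R) n (E : set (n.-tuple T)) :
  measurable E -> \int[mu]_x (r x)%:E = rho%:E ->
  (rho ^+ n ^+ 2 / 2)%:E <= tuple_measure P n E + tuple_measure Q n (~` E).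
Proof.
move=> mE rhoE.
have rho0 : (0 <= rho)%R.
  by rewrite -lee_fin -rhoE integral_ge0// => x _; rewrite lee_fin.
have [->|A0] := eqVneq (rho ^+ n)%R 0%R.
  by rewrite expr0n/= mul0r adde_ge0.
have {}A0 : (0 < rho ^+ n)%R by rewrite lt_neqAle eq_sym A0 exprn_ge0.
set A := (rho ^+ n)%R in A0 *.
pose pn (t : n.-tuple T) := (\prod_(i < n) p (tnth t i))%R.
pose qn (t : n.-tuple T) := (\prod_(i < n) q (tnth t i))%R.
pose rn (t : n.-tuple T) := (\prod_(i < n) r (tnth t i))%R.
have pn0 t : (0 <= pn t)%R by rewrite prodr_ge0.
have qn0 t : (0 <= qn t)%R by rewrite prodr_ge0.
have rpqn t : (rn t ^+ 2 = pn t * qn t)%R.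
  by rewrite /rn -prodrXl -big_split/=; apply: eq_bigr.
have mpn : measurable_fun setT pn by exact: measurable_prod_tnth.
have mqn : measurable_fun setT qn by exact: measurable_prod_tnth.
have mrn : measurable_fun setT rn by exact: measurable_prod_tnth.
have mE' : measurable (~` E) by exact: measurableC.
set mun := tuple_measure mu n.
have intp (B : set (n.-tuple T)) : measurable B ->
    \int[mun]_t ((\1_B t)%:E * (pn t)%:E) = tuple_measure P n B.
  move=> mB; rewrite -(integral_tuple_density p0 mp Pp)//.
  - by rewrite integral_indic// setIT.
  - by apply/measurable_EFinP; exact: measurable_indic.
have intq (B : set (n.-tuple T)) : measurable B ->
    \int[mun]_t ((\1_B t)%:E * (qn t)%:E) = tuple_measure Q n B.
  move=> mB; rewrite -(integral_tuple_density q0 mq Qq)//.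
  - by rewrite integral_indic// setIT.
  - by apply/measurable_EFinP; exact: measurable_indic.
have intpT : \int[mun]_t (pn t)%:E = 1.
  by rewrite integral_prod_tnth// -Pp// P1 -EFin_expe expr1n.
have intqT : \int[mun]_t (qn t)%:E = 1.
  by rewrite integral_prod_tnth// -Qq// Q1 -EFin_expe expr1n.
have mpE : measurable_fun setT (fun t => (\1_E t)%:E * (pn t)%:E).
  apply: emeasurable_funM; apply/measurable_EFinP; last by [].
  exact: measurable_indic.
have mqE : measurable_fun setT (fun t => (\1_(~` E) t)%:E * (qn t)%:E).
  apply: emeasurable_funM; apply/measurable_EFinP; last by [].
  exact: measurable_indic.
have mpn' : measurable_fun setT (fun t => (pn t)%:E) by exact/measurable_EFinP.
have mqn' : measurable_fun setT (fun t => (qn t)%:E) by exact/measurable_EFinP.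
have pE0 t : 0 <= (\1_E t)%:E * (pn t)%:E by rewrite mule_ge0 ?lee_fin.
have qE0 t : 0 <= (\1_(~` E) t)%:E * (qn t)%:E by rewrite mule_ge0 ?lee_fin.
have AE : A%:E <= A^-1%:E * (tuple_measure P n E + tuple_measure Q n (~` E))
                  + (A / 4)%:E * (1 + 1).
  rewrite [X in _ + _ * X](_ : _ =
    \int[mun]_t (pn t)%:E + \int[mun]_t (qn t)%:E); last by rewrite intpT intqT.
  rewrite -intp// -intq//.
  rewrite -!ge0_integralD//; try by move=> t _; rewrite lee_fin.
  rewrite -!ge0_integralZl//; last 6 first.
  - exact: emeasurable_funD.
  - by move=> t _; rewrite adde_ge0 ?lee_fin.
  - by rewrite lee_fin divr_ge0// ltW.
  - exact: emeasurable_funD.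
  - by move=> t _; rewrite adde_ge0.
  - by rewrite lee_fin invr_ge0 ltW.
  rewrite -ge0_integralD//; last 4 first.
  - by move=> t _; rewrite mule_ge0 ?adde_ge0// lee_fin invr_ge0 ltW.
  - by apply: emeasurable_funM => //; exact: emeasurable_funD.
  - by move=> t _; rewrite mule_ge0 ?adde_ge0 ?lee_fin// divr_ge0// ltW.
  - by apply: emeasurable_funM => //; exact: emeasurable_funD.
  rewrite (_ : A%:E = \int[mun]_t (rn t)%:E); last first.
    by rewrite integral_prod_tnth// rhoE -EFin_expe.
  apply: ge0_le_integral => //.
  - by move=> t _; rewrite lee_fin prodr_ge0.
  - exact/measurable_EFinP.
  - by apply: emeasurable_funD; apply: emeasurable_funM => //;
      exact: emeasurable_funD.
  move=> t _.
  rewrite -[leRHS]/((A^-1 * (\1_E t * pn t + \1_(~` E) t * qn t)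
    + A / 4 * (pn t + qn t))%:E) lee_fin.
  (* with A := rho ^+ n, the weights 1 / A and A / 4 have product 1 / 4, as AM-GM
     requires, and this choice is optimal in the final inequality *)
  rewrite !indicE in_setC.
  have A40 : (0 <= A / 4)%R by rewrite divr_ge0// ltW.
  have Ai0 : (0 <= A^-1)%R by rewrite invr_ge0 ltW.
  have AM a b : (0 <= a)%R -> (0 <= b)%R -> (rn t ^+ 2 = a * b)%R ->
      (rn t <= A^-1 * a + A / 4 * b)%R.
    move=> a0 b0 ab.
    have := @ler_amgm2 R (A^-1 * a *+ 2) (A / 4 * b *+ 2) (rn t).
    rewrite -mulrnDl ler_pMn2r//; apply.
    - by rewrite mulrn_wge0// mulr_ge0.
    - by rewrite mulrn_wge0// mulr_ge0.
    - by rewrite ab; field; exact: lt0r_neq0.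
  case: (t \in E) => /=.
    rewrite mul1r mul0r addr0 mulrDr.
    rewrite (le_trans (AM _ _ (pn0 t) (qn0 t) (rpqn t)))// lerD2l.
    by rewrite lerDr mulr_ge0.
  rewrite mul1r mul0r add0r mulrDr addrA.
  rewrite (le_trans (AM _ _ (qn0 t) (pn0 t) _))//; first by rewrite mulrC.
  by rewrite lerDl mulr_ge0.
move: AE; have : 0 <= tuple_measure P n E + tuple_measure Q n (~` E).
  by rewrite adde_ge0.
case: (tuple_measure P n E + tuple_measure Q n (~` E)) => [s| |] //= s0.
  rewrite !lee_fin => AE.
  have : (A * A <= A * (A^-1 * s + A / 4 * (1 + 1)))%R by rewrite ler_pM2l.
  rewrite (_ : A * (_ + _) = s + A * A / 2)%R; last first.
    by field; exact: lt0r_neq0.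
  by rewrite expr2 => ?; lra.
by rewrite leey.
Qed.

End hellinger.

(** * Tilting an exponential density *)

(** From [expR x <= 1 / (1 - x)]; the range [1/2] is what makes the constant 2
    suffice. *)
Lemma expR_le_quadratic (R : realType) (x : R) :
  `|x| <= 2^-1 -> expR x <= 1 + x + 2 * x ^+ 2.
Proof.
rewrite ler_norml => /andP[x1 x2].
have e1 : 1 - x <= expR (- x) by exact: expR_ge1Dx.
have h0 : 0 < 1 - x by lra.
have e2 : expR x <= (1 - x)^-1.
  by rewrite -[expR x]invrK -expRN lef_pV2 ?posrE ?expR_gt0.
rewrite (le_trans e2)// -[leLHS]mul1r ler_pdivrMr//.
rewrite -subr_ge0 (_ : _ - _ = x ^+ 2 * (1 - 2 * x)); last by ring.
by rewrite mulr_ge0 ?sqr_ge0//; lra.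
Qed.

Section bounded_integral.
Context d (T : measurableType d) (R : realType).
Variable mu : {finite_measure set T -> \bar R}.

Lemma bounded_integrable (f : T -> R) (M : R) : measurable_fun setT f ->
  (forall x, `|f x| <= M) -> mu.-integrable setT (EFin \o f).
Proof.
move=> mf fM; apply: measurable_bounded_integrable => //.
  by rewrite -ge0_fin_numE// fin_num_measure.
exists M; split; first exact: num_real.
by move=> x Mx t _; apply: (le_trans (fM t)); exact: ltW.
Qed.

Lemma EFin_Rintegral (f : T -> R) : mu.-integrable setT (EFin \o f) ->
  (\int[mu]_x (f x)%:E)%E = (\int[mu]_x f x)%:E.
Proof. by move=> /integrable_fin_num h; rewrite /Rintegral fineK// h. Qed.

End bounded_integral.

Section tilt.
Context d (T : measurableType d) (R : realType).
Variable mu : {finite_measure set T -> \bar R}.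
Hypothesis mu_gt0 : (0 < mu setT)%E.
Variables (a t : T -> R) (B : R).
Hypotheses (ma : measurable_fun setT a) (mt : measurable_fun setT t).
Hypothesis aB : forall x, `|a x| <= B.
Hypothesis t2 : forall x, `|t x| <= 2^-1.

Let I (f : T -> R) : R := \int[mu]_x f x.

Let mexp (f : T -> R) :
  measurable_fun setT f -> measurable_fun setT (fun x => expR (f x)).
Proof. by move=> mf; exact: measurableT_comp. Qed.

Let ea_le x : expR (a x) <= expR B.
Proof. by rewrite ler_expR (le_trans (ler_norm _)). Qed.

Let ea_ge x : expR (- B) <= expR (a x).
Proof. by rewrite ler_expR lerNl (le_trans (ler_norm _))// normrN. Qed.

Let t1 x : `|t x| <= 1.
Proof. by rewrite (le_trans (t2 x))// invf_le1// ler1n. Qed.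

Lemma integrable_exp_tilt (s : T -> R) : measurable_fun setT s ->
  (forall x, `|s x| <= 1) ->
  mu.-integrable setT (EFin \o (fun x => expR (a x + s x))).
Proof.
move=> ms s1; apply: (@bounded_integrable _ _ _ _ _ (expR (B + 1))) => [|x].
  by apply: mexp; exact: measurable_funD.
rewrite gtr0_norm ?expR_gt0// ler_expR lerD//.
  by rewrite (le_trans (ler_norm _)).
by rewrite (le_trans (ler_norm _)).
Qed.

Let int1 (f : T -> R) : measurable_fun setT f -> (forall x, `|f x| <= 1) ->
  mu.-integrable setT (EFin \o (fun x => f x * expR (a x))).
Proof.
move=> mf f1; apply: (@bounded_integrable _ _ _ _ _ (expR B)) => [|x].
  by apply: measurable_funM => //; exact: mexp.
rewrite normrM (gtr0_norm (expR_gt0 _)) -[leRHS]mul1r ler_pM//.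
Qed.

Let vol : R := fine (mu setT).

Let vol_gt0 : 0 < vol.
Proof.
by rewrite fine_gt0// mu_gt0/= -ge0_fin_numE// fin_num_measure.
Qed.

Lemma Rintegral_exp_gt0 (f : T -> R) :
  mu.-integrable setT (EFin \o (fun x => expR (f x))) -> (exists M, forall x, `|f x| <= M) ->
  0 < I (fun x => expR (f x)).
Proof.
move=> If [M fM]; have -> : 0 = expR (- M) * 0 :> R by rewrite mulr0.
apply: (@lt_le_trans _ _ (\int[mu]_(x in setT) expR (- M))).
  by rewrite Rintegral_cst// ltr_pM2l ?expR_gt0.
apply: le_Rintegral; [by []| |by []|].
  exact: finite_measure_integrable_cst.
by move=> x _; rewrite ler_expR lerNl (le_trans (ler_norm _))// normrN.
Qed.

(** A bound for the affinity lost by perturbing the exponent [a] by [t] and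
    by [- t]. The factor [expR B ^+ 2] compares the mean of [t ^+ 2] under the
    density proportional to [expR a] with its mean under [mu]. *)
Definition tilt_cost : R := 2 * expR B ^+ 2 * I (fun x => t x ^+ 2) / vol.

Lemma tilt_cost_ge0 : 0 <= tilt_cost.
Proof.
rewrite divr_ge0 ?(ltW vol_gt0)// !mulr_ge0 ?sqr_ge0//.
by apply: Rintegral_ge0 => x _; exact: sqr_ge0.
Qed.

(** The first-order terms in [t] have opposite signs in the two factors, so they
    enter the product only as minus a square. *)
Lemma tilt_normalizers :
  I (fun x => expR (a x + t x)) * I (fun x => expR (a x - t x)) <=
  (I (fun x => expR (a x)) * (1 + tilt_cost)) ^+ 2.
Proof.
pose Z0 := I (fun x => 1 * expR (a x)).
pose m1 := I (fun x => t x * expR (a x)).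
pose m2 := I (fun x => t x ^+ 2 * expR (a x)).
have -> : I (fun x => expR (a x)) = Z0.
  by apply: eq_Rintegral => x _; rewrite mul1r.
have mt2 : measurable_fun setT (fun x => t x ^+ 2) by exact: measurable_funX.
have t21 x : `|t x ^+ 2| <= 1 by rewrite normrX exprn_ile1.
have i0 : mu.-integrable setT (EFin \o (fun x => 1 * expR (a x))).
  by apply: int1 => // x; rewrite normr1.
have i1 : mu.-integrable setT (EFin \o (fun x => t x * expR (a x))).
  exact: int1.
have i2 : mu.-integrable setT (EFin \o (fun x => t x ^+ 2 * expR (a x))).
  exact: int1.
have key (e : R) (s : T -> R) : measurable_fun setT s ->
    (forall x, `|s x| <= 2^-1) -> (forall x, s x = e * t x) -> e ^+ 2 = 1 ->
    I (fun x => expR (a x + s x)) <= Z0 + e * m1 + 2 * m2.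
  move=> ms s2 st e2.
  have s1 x : `|s x| <= 1 by rewrite (le_trans (s2 x))// invf_le1// ler1n.
  have i1' : mu.-integrable setT (EFin \o (fun x => e * (t x * expR (a x)))).
    exact: (integrableZl measurableT e i1).
  have i2' : mu.-integrable setT (EFin \o (fun x => 2 * (t x ^+ 2 * expR (a x)))).
    exact: (integrableZl measurableT 2 i2).
  have i01 : mu.-integrable setT
      (EFin \o (fun x => 1 * expR (a x) + e * (t x * expR (a x)))).
    exact: (integrableD measurableT i0 i1').
  rewrite /m1 /m2 /I -!RintegralZl// -!RintegralD//.
  apply: le_Rintegral => //.
  - exact: integrable_exp_tilt.
  - exact: (integrableD measurableT i01 i2').
  move=> x _; rewrite expRD -!mulrA mulrCA.
  rewrite (_ : _ + _ = expR (a x) * (1 + s x + 2 * s x ^+ 2)); last first.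
    by rewrite st exprMn e2; ring.
  by rewrite ler_pM2l ?expR_gt0//; exact: expR_le_quadratic.
have kp : I (fun x => expR (a x + t x)) <= Z0 + m1 + 2 * m2.
  by rewrite -[m1]mul1r; apply: key => //; [move=> x; rewrite mul1r|rewrite expr1n].
have km : I (fun x => expR (a x - t x)) <= Z0 - m1 + 2 * m2.
  rewrite -mulN1r; apply: key => //; last by rewrite sqrrN expr1n.
  - exact: measurable_funN.
  - by move=> x; rewrite normrN.
  - by move=> x; rewrite mulN1r.
have Z0_ge : expR (- B) * vol <= Z0.
  rewrite -Rintegral_cst//; apply: le_Rintegral => //.
    exact: finite_measure_integrable_cst.
  by move=> x _; rewrite mul1r.
have m2_ge0 : 0 <= m2.
  by apply: Rintegral_ge0 => x _; rewrite mulr_ge0 ?sqr_ge0// expR_ge0.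
have it2 : mu.-integrable setT (EFin \o (fun x => t x ^+ 2)).
  exact: (@bounded_integrable _ _ _ _ _ 1).
have m2_le : m2 <= expR B * I (fun x => t x ^+ 2).
  rewrite /m2 /I -RintegralZl//; apply: le_Rintegral => //.
    exact: (integrableZl measurableT _ it2).
  by move=> x _; rewrite mulrC ler_wpM2r ?sqr_ge0.
have m2K : 2 * m2 <= Z0 * tilt_cost.
  apply: (@le_trans _ _ (expR (- B) * vol * tilt_cost)); last first.
    by rewrite ler_wpM2r// tilt_cost_ge0.
  rewrite (_ : _ * tilt_cost = 2 * (expR B * I (fun x => t x ^+ 2))).
    by rewrite ler_pM2l.
  rewrite /tilt_cost expRN; field.
  by rewrite !lt0r_neq0// expR_gt0.
have Ip : 0 <= I (fun x => expR (a x + t x)).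
  by apply: Rintegral_ge0 => x _; exact: expR_ge0.
have Im : 0 <= I (fun x => expR (a x - t x)).
  by apply: Rintegral_ge0 => x _; exact: expR_ge0.
apply: (le_trans (ler_pM Ip Im kp km)).
apply: (@le_trans _ _ ((Z0 + 2 * m2) ^+ 2)).
  rewrite -subr_ge0 (_ : _ - _ = m1 ^+ 2) ?sqr_ge0//; ring.
have Z0_ge0 : 0 <= Z0.
  by rewrite (le_trans _ Z0_ge)// mulr_ge0 ?expR_ge0 ?ltW.
have Z0K_ge0 : 0 <= Z0 * tilt_cost by rewrite mulr_ge0 ?tilt_cost_ge0.
rewrite mulrDr mulr1; have : Z0 + 2 * m2 <= Z0 + Z0 * tilt_cost by rewrite lerD2l.
by rewrite -[in X in X -> _]ler_sqr// nnegrE addr_ge0// mulr_ge0.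
Qed.

Variables (P Q : {sigma_finite_measure set T -> \bar R}).
Let Zp := I (fun x => expR (a x + t x)).
Let Zq := I (fun x => expR (a x - t x)).
Hypothesis Pp : forall A, measurable A ->
  P A = (\int[mu]_(x in A) (Zp^-1 * expR (a x + t x))%:E)%E.
Hypothesis Qq : forall A, measurable A ->
  Q A = (\int[mu]_(x in A) (Zq^-1 * expR (a x - t x))%:E)%E.

(** The affinity of the two tilted densities is the normalizer of [expR a] over
    the geometric mean of theirs, hence at least [1 / (1 + tilt_cost)] by
    [tilt_normalizers]; its powers are compared with exponentials, by
    [1 + x <= expR x] used once in each direction. *)
Lemma two_point_error_tilt n (E : set (n.-tuple T)) : measurable E ->
  (((1 - 2 * n%:R * tilt_cost) / 2)%:E <=
   tuple_measure P n E + tuple_measure Q n (~` E))%E.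
Proof.
move=> mE.
have mNt : measurable_fun setT (fun x => - t x) by exact: measurable_funN.
have Nt1 x : `|- t x| <= 1 by rewrite normrN.
have i0 : mu.-integrable setT (EFin \o (fun x => expR (a x))).
  apply: (@bounded_integrable _ _ _ _ _ (expR B)) => [|x]; first exact: mexp.
  by rewrite gtr0_norm ?expR_gt0.
have ip := integrable_exp_tilt mt t1.
have iq := integrable_exp_tilt mNt Nt1.
have bnd (s : T -> R) : (forall x, `|s x| <= 1) -> exists M, forall x, `|a x + s x| <= M.
  by move=> s1; exists (B + 1) => x; rewrite (le_trans (ler_normD _ _))// lerD.
have Zp0 : 0 < Zp by apply: Rintegral_exp_gt0 => //; exact: bnd.
have Zq0 : 0 < Zq by apply: Rintegral_exp_gt0 => //; exact: bnd.
have Z00 : 0 < I (fun x => expR (a x)).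
  by apply: Rintegral_exp_gt0 => //; exists B.
set Z0 := I _ in Z00.
pose rho := Z0 / Num.sqrt (Zp * Zq).
pose r x := (Num.sqrt (Zp * Zq))^-1 * expR (a x).
have rhoE : (\int[mu]_x (r x)%:E = rho%:E)%E.
  rewrite EFin_Rintegral; last exact: (integrableZl measurableT _ i0).
  by rewrite RintegralZl// mulrC.
have total (s : T -> R) (Z := I (fun x => expR (a x + s x))) :
    mu.-integrable setT (EFin \o (fun x => expR (a x + s x))) -> 0 < Z ->
    (\int[mu]_x (Z^-1 * expR (a x + s x))%:E = 1)%E.
  move=> ias Z0'; rewrite EFin_Rintegral; last exact: (integrableZl measurableT _ ias).
  by rewrite RintegralZl// mulVf// gt_eqF.
have mpos (Z : R) (s : T -> R) : measurable_fun setT s ->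
    measurable_fun setT (fun x => Z * expR (a x + s x)).
  move=> ms; apply: measurable_funM => //.
  by apply: mexp; exact: measurable_funD.
have pos (Z : R) (s : T -> R) : 0 < Z -> forall x, 0 <= Z^-1 * expR (a x + s x).
  by move=> Zs x; rewrite mulr_ge0 ?invr_ge0 ?expR_ge0// ltW.
apply: le_trans (@two_point_error_affinity _ _ _ mu P Q
  (fun x => Zp^-1 * expR (a x + t x)) (fun x => Zq^-1 * expR (a x - t x)) r
  (pos _ _ Zp0) (mpos _ _ mt) (pos _ _ Zq0) (mpos _ _ mNt) _ _ _ Pp Qq _ _ rho n E mE rhoE).
- rewrite lee_fin ler_pM2r ?invr_gt0//.
  set K := tilt_cost; have K0 : 0 <= K := tilt_cost_ge0.
  have rho2 : rho ^+ 2 = Z0 ^+ 2 / (Zp * Zq).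
    by rewrite expr_div_n sqr_sqrtr// mulr_ge0 ?ltW.
  have rhoK : ((1 + K) ^+ 2)^-1 <= rho ^+ 2.
    rewrite rho2 ler_pdivlMr ?mulr_gt0// mulrC ler_pdivrMr ?exprn_gt0 ?ltr_pwDl//.
    by rewrite -exprMn; exact: tilt_normalizers.
  rewrite exprAC (le_trans _ (lerXn2r n _ _ rhoK)) ?nnegrE ?invr_ge0 ?sqr_ge0//.
  have -> : ((1 + K) ^+ 2)^-1 ^+ n = ((1 + K) ^+ (2 * n))^-1.
    by rewrite exprVn exprM.
  apply: (@le_trans _ _ (expR (- ((2 * n)%:R * K)))).
    by rewrite natrM; exact: expR_ge1Dx.
  rewrite expRN lef_pV2 ?posrE ?expR_gt0 ?exprn_gt0 ?ltr_pwDl//.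
  rewrite expRM_natl lerXn2r ?nnegrE ?expR_ge0 ?addr_ge0//.
  exact: expR_ge1Dx.
- by move=> x; rewrite mulr_ge0 ?invr_ge0 ?sqrtr_ge0 ?expR_ge0.
- by apply: measurable_funM => //; exact: mexp.
- move=> x; rewrite exprMn exprVn sqr_sqrtr ?mulr_ge0 ?ltW// !expRD expRN.
  field; rewrite !gt_eqF ?expR_gt0//.
- by rewrite Pp// total.
- by rewrite Qq// total.
Qed.

End tilt.

(** * The Borel structure of the sphere *)

Section sphere_measurability.
Context (R : realType) (m : nat).
Implicit Types x y : sphere R m.

Lemma measurable_coord (i : 'I_m.+1) :
  measurable_fun setT (fun x : sphere R m => val x 0 i : R).
Proof.
move=> _ Y mY; rewrite setTI.
exists ((@tnth _ (measurableTypeR R) ^~ i) @^-1` Y).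
  by rewrite -[X in measurable X]setTI; exact: measurable_tnth.
by rewrite setTI; apply/seteqP; split => x /=; rewrite tnth_mktuple.
Qed.

(** The sigma-algebra of the sphere is the one generated by the coordinates. *)
Lemma measurable_sphere_coord d (T : measurableType d) (f : T -> sphere R m) :
  (forall i, measurable_fun setT (fun t => val (f t) 0 i : R)) ->
  measurable_fun setT f.
Proof.
move=> mf _ _ [B mB <-]; rewrite !setTI -comp_preimage -[X in measurable X]setTI.
suff : measurable_fun setT (@sphere_coord R m \o f) by apply.
apply/measurable_fun_tnthP => i.
rewrite (_ : _ \o _ = fun t => val (f t) 0 i); first exact: mf.
by apply/funext => t /=; rewrite tnth_mktuple.
Qed.

Lemma measurable_dotp (a : 'rV[R]_m.+1) :
  measurable_fun setT (fun x : sphere R m => dotp (val x) a).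
Proof.
apply: measurable_sum => i; apply: measurable_funM => //.
exact: measurable_coord.
Qed.

End sphere_measurability.

(** * The Riemannian volume in the stereographic chart *)

Section volume_element.
Context (R : realType) (m : nat).

Lemma dotp_ge0 n (u : 'rV[R]_n) : 0 <= dotp u u.
Proof. by apply: sumr_ge0 => i _; rewrite -expr2 sqr_ge0. Qed.

Lemma dotp_delta n (u : 'rV[R]_n) i : dotp u (delta_mx 0 i) = u 0 i.
Proof.
rewrite /dotp (bigD1 i)//= big1 ?addr0 => [|j ji]; rewrite mxE eqxx/=.
  by rewrite eqxx mulr1.
by rewrite (negbTE ji) mulr0.
Qed.

(** Stereographic projection is conformal: the spherical metric is this factor
    squared times the Euclidean metric of the chart. *)
Definition conformal_factor (u : 'rV[R]_m) : R := 2 / (1 + dotp u u).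

Let oneDdotp_neq0 (u : 'rV[R]_m) : 1 + dotp u u != 0.
Proof. by rewrite gt_eqF// ltr_pwDl// dotp_ge0. Qed.

Lemma conformal_factor_gt0 u : 0 < conformal_factor u.
Proof. by rewrite divr_gt0// ltr_pwDl// dotp_ge0. Qed.

Lemma is_derive_coord (u v : 'rV[R]_m) i :
  is_derive u v (fun w : 'rV[R]_m => w 0 i : R) (v 0 i).
Proof.
have dc : derivable (fun w : 'rV[R]_m => w 0 i : R) u v.
  exact/diff_derivable/differentiable_coord.
apply: DeriveDef => //; have := @derive_id _ _ u v.
by rewrite derive_mx// => /(congr1 (fun M : 'rV_m => M 0 i)); rewrite mxE.
Qed.

Lemma differentiable_dotp (u : 'rV[R]_m) :
  differentiable (fun w : 'rV[R]_m => 1 + dotp w w : R) u.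
Proof.
rewrite (_ : (fun _ => _) = cst 1 +
    \sum_(i < m) (fun w : 'rV[R]_m => w 0 i : R) * (fun w => w 0 i)).
  apply: differentiableD; first exact: differentiable_cst.
  by apply: differentiable_sum => i; apply: differentiableM;
    exact: differentiable_coord.
by apply/funext => w /=; rewrite fctE fct_sumE.
Qed.

Lemma derive_dotp (u v : 'rV[R]_m) :
  'D_v (fun w : 'rV[R]_m => 1 + dotp w w : R) u = 2 * dotp u v.
Proof.
rewrite (_ : (fun _ => _) = cst 1 +
    \sum_(i < m) (fun w : 'rV[R]_m => w 0 i : R) * (fun w => w 0 i)); last first.
  by apply/funext => w /=; rewrite fctE fct_sumE.
have dc i := is_derive_coord u v i.
rewrite derive_val /= add0r mulr_sumr; apply: eq_bigr => i _.
by rewrite /GRing.scale/=; ring.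
Qed.

Lemma differentiable_conformal_factor (u : 'rV[R]_m) :
  differentiable (conformal_factor : 'rV[R]_m -> R) u.
Proof.
apply: differentiableM; first exact: differentiable_cst.
by apply: differentiableV; [exact: differentiable_dotp|exact: oneDdotp_neq0].
Qed.

Lemma derive_conformal_factor (u v : 'rV[R]_m) :
  'D_v conformal_factor u = - conformal_factor u ^+ 2 * dotp u v.
Proof.
(* differentiate the product conformal_factor * (1 + dotp), which is constant *)
have dg : derivable (conformal_factor : 'rV[R]_m -> R) u v.
  exact/diff_derivable/differentiable_conformal_factor.
have dd : derivable (fun w : 'rV[R]_m => 1 + dotp w w : R) u v.
  exact/diff_derivable/differentiable_dotp.
have := deriveM dg dd; rewrite derive_dotp.
rewrite (_ : conformal_factor * _ = cst 2); last first.
  by apply/funext => w; rewrite fctE /conformal_factor divfK.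
rewrite derive_cst /GRing.scale/= => /esym/eqP; rewrite addrC addr_eq0 => /eqP h.
apply: (mulfI (oneDdotp_neq0 u)); rewrite h /conformal_factor.
by field.
Qed.

Lemma stereoE (u : 'rV[R]_m) k : stereo u 0 k =
  if unlift ord0 k is Some j then conformal_factor u * u 0 j
  else 1 - conformal_factor u.
Proof.
case: unliftP => [j|] ->; first by rewrite stereoS.
rewrite stereo0 /conformal_factor; field; exact: oneDdotp_neq0.
Qed.

(* the coordinates of stereo in the form of stereoE, which is easy to
   differentiate: 1 - g on the axis and g * u_j elsewhere *)
Let stereo_comp (k : 'I_m.+1) (u : 'rV[R]_m) : R := stereo u 0 k.

Lemma differentiable_stereo_comp k (u : 'rV[R]_m) :
  differentiable (stereo_comp k) u.
Proof.
have dg := differentiable_conformal_factor u.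
rewrite (_ : stereo_comp k = if unlift ord0 k is Some j then
    conformal_factor * (fun w : 'rV[R]_m => w 0 j : R)
    else cst 1 - conformal_factor).
  case: unliftP => [j|] _.
    by apply: differentiableM => //; exact: differentiable_coord.
  by apply: differentiableB => //; exact: differentiable_cst.
by apply/funext => w; rewrite /stereo_comp stereoE; case: unliftP.
Qed.

Lemma differentiable_stereo (u : 'rV[R]_m) : differentiable (@stereo R m) u.
Proof.
rewrite (_ : @stereo R m = \sum_(k < m.+1)
    (fun w : 'rV[R]_m => stereo_comp k w *: (delta_mx 0 k : 'rV[R]_m.+1))).
  apply: differentiable_sum => k; apply: differentiableZl.
  exact: differentiable_stereo_comp.
by apply/funext => w; rewrite fct_sumE -row_sum_delta.
Qed.

Lemma jacobian_stereoE (u : 'rV[R]_m) i k : 'J (@stereo R m) u i k =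
  if unlift ord0 k is Some j then
    conformal_factor u * (i == j)%:R - conformal_factor u ^+ 2 * u 0 i * u 0 j
  else conformal_factor u ^+ 2 * u 0 i.
Proof.
have dstereo := differentiable_stereo u.
have dg : derivable (conformal_factor : 'rV[R]_m -> R) u (delta_mx 0 i).
  exact/diff_derivable/differentiable_conformal_factor.
have -> : 'J (@stereo R m) u i k = 'D_(delta_mx 0 i) (stereo_comp k) u.
  transitivity (row i ('J (@stereo R m) u) 0 k); first by rewrite [RHS]mxE.
  rewrite rowE -deriveEjacobian// derive_mx; last exact: diff_derivable.
  by rewrite mxE.
rewrite (_ : stereo_comp k = if unlift ord0 k is Some j then
    conformal_factor * (fun w : 'rV[R]_m => w 0 j : R)
    else cst 1 - conformal_factor); last first.
  by apply/funext => w; rewrite /stereo_comp stereoE; case: unliftP.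
case: unliftP => [j|] _.
  have dc := is_derive_coord u (delta_mx 0 i) j.
  rewrite deriveM// derive_conformal_factor dotp_delta derive_val mxE eqxx/=.
  by rewrite /GRing.scale/= (eq_sym j i); ring.
rewrite deriveB// derive_cst derive_conformal_factor dotp_delta; ring.
Qed.

(** The off-diagonal terms cancel by the relation [g * (1 + dotp u u) = 2]. *)
Lemma metric_tensor_stereo (u : 'rV[R]_m) :
  metric_tensor u = (conformal_factor u ^+ 2)%:M.
Proof.
set g := conformal_factor u.
have gE : g * (1 + dotp u u) = 2 by rewrite /g /conformal_factor divfK.
rewrite /metric_tensor; have := jacobian_stereoE u.
move: ('J (@stereo R m) u) => J JE.
apply/matrixP => i k; rewrite !mxE big_ord_recl !mxE !JE unlift_none -/g.
under eq_bigr do rewrite mxE !JE liftK -/g.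
have -> : \sum_(j < m) (g * (i == j)%:R - g ^+ 2 * u 0 i * u 0 j) *
     (g * (k == j)%:R - g ^+ 2 * u 0 k * u 0 j) =
   g ^+ 2 * (i == k)%:R - 2 * g ^+ 3 * u 0 i * u 0 k
     + g ^+ 4 * u 0 i * u 0 k * dotp u u.
  under eq_bigr => j _.
    rewrite (_ : _ * _ = g ^+ 2 * ((i == j)%:R * (k == j)%:R)
      - g ^+ 3 * (u 0 k * (u 0 j * (i == j)%:R) + u 0 i * (u 0 j * (k == j)%:R))
      + g ^+ 4 * u 0 i * u 0 k * (u 0 j * u 0 j)); last by ring.
    over.
  rewrite big_split/= sumrB -!mulr_sumr big_split/= -!mulr_sumr.
  have pick (f : 'I_m -> R) l : \sum_(j < m) f j * (l == j)%:R = f l.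
    rewrite (bigD1 l)//= big1 ?addr0 ?eqxx ?mulr1// => j.
    by rewrite eq_sym => /negbTE ->; rewrite mulr0.
  rewrite !pick eq_sym -/(dotp u u); ring.
rewrite -[RHS]mulr_natr.
transitivity (g ^+ 2 * (i == k)%:R
    + g ^+ 3 * u 0 i * u 0 k * (g * (1 + dotp u u) - 2)); first by ring.
by rewrite gE subrr mulr0 addr0.
Qed.

Lemma sqrt_det_metric_tensor (u : 'rV[R]_m) :
  Num.sqrt (\det (metric_tensor u)) = conformal_factor u ^+ m.
Proof.
rewrite metric_tensor_stereo det_scalar exprAC sqrtr_sqr ger0_norm//.
by rewrite exprn_ge0// ltW// conformal_factor_gt0.
Qed.

End volume_element.

Section chart_measure.
Context (R : realType) (m : nat).
Local Notation mR := (measurableTypeR R).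
Local Notation lebn := (tuple_measure (@lebesgue_measure R) m).
Implicit Types u : m.-tuple mR.

Definition row_of_tuple (u : m.-tuple mR) : 'rV[R]_m := \row_i tnth u i.

(** The density of [dvol] in the chart, by [sqrt_det_metric_tensor]. *)
Definition volume_weight u : R := conformal_factor (row_of_tuple u) ^+ m.

Lemma volume_weight_ge0 u : 0 <= volume_weight u.
Proof. by rewrite exprn_ge0// ltW// conformal_factor_gt0. Qed.

Lemma measurable_dotp_row :
  measurable_fun setT (fun u => dotp (row_of_tuple u) (row_of_tuple u)).
Proof.
apply: measurable_sum => i.
rewrite (_ : (fun _ => _) = fun u => tnth u i * tnth u i).
  by apply: measurable_funM; exact: measurable_tnth.
by apply/funext => u; rewrite mxE.
Qed.

Lemma measurable_conformal_factor :
  measurable_fun setT (fun u => conformal_factor (row_of_tuple u)).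
Proof.
apply: measurable_funM => //.
(* the inverse of a positive function is expR (- ln), which is measurable *)
rewrite (_ : (fun _ => _) = fun u =>
    expR (- ln (1 + dotp (row_of_tuple u) (row_of_tuple u)))).
  do 2 apply: measurableT_comp => //.
  apply: measurableT_comp; first exact: measurable_ln.
  by apply: measurable_funD => //; exact: measurable_dotp_row.
by apply/funext => u; rewrite expRN lnK// posrE ltr_pwDl// dotp_ge0.
Qed.

Lemma measurable_volume_weight : measurable_fun setT volume_weight.
Proof. by apply: measurable_funX; exact: measurable_conformal_factor. Qed.

Lemma measurable_chart : measurable_fun setT (@chart R m).
Proof.
apply: measurable_sphere_coord => i.
rewrite (_ : (fun _ => _) = fun u => if unlift ord0 i is Some j then
    conformal_factor (row_of_tuple u) * tnth u j
    else 1 - conformal_factor (row_of_tuple u)).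
  have mc := measurable_conformal_factor.
  case: unliftP => [j _|_]; last exact: measurable_funB.
  by apply: measurable_funM => //; exact: measurable_tnth.
apply/funext => u /=; rewrite stereoE; case: unliftP => [j|] _ //.
by rewrite mxE.
Qed.

Definition chart_volume (A : set (m.-tuple mR)) : \bar R :=
  (\int[lebn]_(u in A) (volume_weight u)%:E)%E.

Let chart_volume0 : chart_volume set0 = 0%E.
Proof. exact: integral_set0. Qed.

Let chart_volume_ge0 A : (0 <= chart_volume A)%E.
Proof. by apply: integral_ge0 => u _; rewrite lee_fin volume_weight_ge0. Qed.

Let chart_volume_sigma_additive : semi_sigma_additive chart_volume.
Proof.
apply: semi_sigma_additive_nng_induced.
  by apply/measurable_EFinP; exact: measurable_volume_weight.
by move=> u; rewrite lee_fin volume_weight_ge0.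
Qed.

HB.instance Definition _ := isMeasure.Build _ _ _ chart_volume
  chart_volume0 chart_volume_ge0 chart_volume_sigma_additive.

Lemma integral_lorentzian :
  (\int[@lebesgue_measure R]_x (2 / (1 + x ^+ 2))%:E)%E \is a fin_num.
Proof.
have den0 (x : R) : 0 < 1 + x ^+ 2 by rewrite ltr_pwDl// sqr_ge0.
have phi0 (x : R) : (0%:E <= (2 / (1 + x ^+ 2))%:E)%E.
  by rewrite lee_fin divr_ge0// ltW.
have mphi : measurable_fun setT (fun x : R => (2 / (1 + x ^+ 2))%:E).
  apply/measurable_EFinP; apply: continuous_measurable_fun => x.
  apply: cvgM; first exact: cvg_cst.
  exact: (@continuous_oneDsqrV R).
have mN : measurable (`]-oo, 0]%classic : set (measurableTypeR R)) by [].
have half : (\int[@lebesgue_measure R]_(x in `[0%R, +oo[)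
    (2 / (1 + x ^+ 2))%:E < +oo)%E.
  under eq_integral do rewrite EFinM.
  rewrite ge0_integralZl//; last 2 first.
  - apply/measurable_EFinP/measurable_funTS; apply: continuous_measurable_fun.
    exact: continuous_oneDsqrV.
  - by move=> x _; rewrite lee_fin invr_ge0 ltW.
  by rewrite integral0y_oneDsqr -EFinM ltry.
rewrite ge0_fin_numE; last by apply: integral_ge0 => x _; exact: phi0.
rewrite -(setUv `]-oo, 0]%classic) ge0_integral_setU//; last 3 first.
- exact: measurableC.
- by rewrite setUv.
- by rewrite disj_set2E setICr.
rewrite lte_add_pinfty//.
  have := ge0_integration_by_substitution0 mphi phi0.
  by under [in X in _ = X -> _]eq_integral do rewrite sqrrN; move=> <-.
apply: le_lt_trans half; apply: ge0_subset_integral => //.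
- exact: measurableC.
- exact: measurable_funTS.
- by move=> x /=; rewrite !in_itv/= andbT => /negP; rewrite -ltNge => /ltW.
Qed.

(** [1 + |u|^2] dominates each [1 + u_i^2], so the weight is at most a product of
    m one-dimensional Lorentzian profiles, each integrable. *)
Lemma chart_volume_fin_num : chart_volume setT \is a fin_num.
Proof.
rewrite ge0_fin_numE//.
pose phi (x : mR) : R := 2 / (1 + x ^+ 2).
have den0 (x : R) : 0 < 1 + x ^+ 2 by rewrite ltr_pwDl// sqr_ge0.
have phi0 x : 0 <= phi x by rewrite divr_ge0// ltW.
have mphi : measurable_fun setT phi.
  apply: continuous_measurable_fun => x; apply: cvgM; first exact: cvg_cst.
  exact: (@continuous_oneDsqrV R).
apply: (@le_lt_trans _ _ (\int[lebn]_u (\prod_(i < m) phi (tnth u i))%:E)%E).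
  apply: ge0_le_integral => //.
  - by move=> u _; rewrite lee_fin volume_weight_ge0.
  - by apply/measurable_EFinP; exact: measurable_volume_weight.
  - by apply/measurable_EFinP; exact: measurable_prod_tnth.
  move=> u _; rewrite lee_fin /volume_weight -[X in _ ^+ X]card_ord -prodr_const.
  apply: ler_prod => i _; rewrite ltW ?conformal_factor_gt0//=.
  rewrite ler_pM2l// lef_pV2 ?posrE ?ltr_pwDl ?dotp_ge0//; last by rewrite sqr_ge0.
  rewrite lerD2l /dotp (bigD1 i)//= mxE -expr2 lerDl.
  by apply: sumr_ge0 => j _; rewrite -expr2 sqr_ge0.
rewrite integral_prod_tnth// -(fineK integral_lorentzian) -EFin_expe.
by rewrite ltry.
Qed.

(** On the unit cube [|u|^2 <= m] bounds the weight from below. *)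
Lemma chart_volume_gt0 : (0 < chart_volume setT)%E.
Proof.
pose phi (x : mR) : R := \1_(`[0, 1]%classic : set mR) x.
have phi0 x : 0 <= phi x by [].
have mphi : measurable_fun setT phi by exact: measurable_indic.
have c0 : 0 < (2 / (1 + m%:R)) ^+ m :> R.
  by rewrite exprn_gt0// divr_gt0// ltr_pwDl.
apply: (@lt_le_trans _ _ (\int[lebn]_u
    (((2 / (1 + m%:R)) ^+ m)%:E * (\prod_(i < m) phi (tnth u i))%:E))%E).
  rewrite ge0_integralZl//; last 2 first.
  - by apply/measurable_EFinP; exact: measurable_prod_tnth.
  - by move=> u _; rewrite lee_fin prodr_ge0.
  rewrite integral_prod_tnth// (_ : \int[_]_x _ = 1)%E.
    by rewrite -EFin_expe expr1n mule1 lte_fin.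
  rewrite integral_indic//= setIT.
  by rewrite lebesgue_measure_itv/= lte_fin ltr01 -EFinB subr0.
apply: ge0_le_integral => //.
- by move=> u _; rewrite mule_ge0// lee_fin ?prodr_ge0// ltW.
- apply: emeasurable_funM; first exact: measurable_cst.
  by apply/measurable_EFinP; exact: measurable_prod_tnth.
- by apply/measurable_EFinP; exact: measurable_volume_weight.
move=> u _; rewrite -EFinM lee_fin.
have [u01|] := boolP [forall i, 0 <= (tnth u i : R) <= 1]; last first.
  rewrite negb_forall => /existsP[i ui].
  rewrite (bigD1 i)//= /phi indicE mem_setE in_itv/=.
  rewrite (negbTE ui) mul0r mulr0; exact: volume_weight_ge0.
rewrite big1 ?mulr1 => [|i _]; last first.
  by rewrite /phi indicE mem_setE/= in_itv/= (forallP u01).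
rewrite lerXn2r ?nnegrE ?divr_ge0 ?addr_ge0 ?dotp_ge0//.
rewrite ler_pM2l// lef_pV2 ?posrE ?ltr_pwDl ?dotp_ge0// lerD2l.
rewrite /dotp -[m in m%:R]card_ord -sum1_card natr_sum ler_sum// => i _.
rewrite mxE; have /andP[ui0 ui1] := forallP u01 i.
by rewrite -[leRHS]mulr1 ler_pM.
Qed.

Lemma dvolE : @dvol R m = pushforward chart_volume (@chart R m).
Proof.
apply/funext => A; rewrite /dvol /pushforward /chart_volume.
by apply: eq_integral => u _; rewrite sqrt_det_metric_tensor.
Qed.

Let pushm := measure_function_pushforward__canonical__measure_function_Measure
  chart_volume measurable_chart.

Let dvol0 : @dvol R m set0 = 0%E.
Proof. by rewrite dvolE; exact: (measure0 pushm). Qed.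

Let dvol_ge0 A : (0 <= @dvol R m A)%E.
Proof. by rewrite dvolE; exact: (measure_ge0 pushm). Qed.

Let dvol_sigma_additive : semi_sigma_additive (@dvol R m).
Proof. by rewrite dvolE; exact: (@measure_semi_sigma_additive _ _ _ pushm). Qed.

HB.instance Definition _ := isMeasure.Build _ _ _ (@dvol R m)
  dvol0 dvol_ge0 dvol_sigma_additive.

Lemma dvolT : @dvol R m setT = chart_volume setT.
Proof. by rewrite dvolE /pushforward preimage_setT. Qed.

Let dvol_fin_num : fin_num_fun (@dvol R m).
Proof.
move=> A mA; rewrite ge0_fin_numE//.
apply: (@le_lt_trans _ _ (@dvol R m setT)); first by rewrite le_measure ?inE.
by rewrite dvolT -ge0_fin_numE// chart_volume_fin_num.
Qed.

HB.instance Definition _ := Measure_isFinite.Build _ _ _ (@dvol R m) dvol_fin_num.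

Lemma dvol_gt0 : (0 < @dvol R m setT)%E.
Proof. by rewrite dvolT chart_volume_gt0. Qed.

End chart_measure.

(** * Geodesic and Euclidean distance *)

Lemma sin_le_id (R : realType) (x : R) : 0 <= x -> sin x <= x.
Proof.
move=> x0; rewrite -subr_ge0.
pose f (y : R) := y - sin y.
have df (y : R) : is_derive y 1 f (1 - cos y) by apply: is_deriveB.
have f0 : f 0 = 0 by rewrite /f sin0 subrr.
rewrite -[leRHS]/(f x) -f0.
apply: (@ger0_derive1_ndecry _ f 0) => // [y _|].
- by rewrite derive1E derive_val subr_ge0 cos_le1.
- apply: continuous_subspaceT => y.
  by apply/differentiable_continuous/derivable1_diffP.
Qed.

(** Half-angle formula: the left-hand side is [4 sin^2 (x / 2)]. *)
Lemma onesubcos_le (R : realType) (x : R) : 0 <= x <= pi ->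
  2 - 2 * cos x <= x ^+ 2.
Proof.
move=> /andP[x0 xpi].
have xE : x = (x / 2) *+ 2 by rewrite -mulr_natr divfK.
rewrite [in cos x]xE cos_mulr2n cos2sin2.
have h0 : 0 <= x / 2 by rewrite divr_ge0.
have s0 : 0 <= sin (x / 2).
  by apply: sin_ge0_pi; rewrite h0/= (le_trans _ xpi)//; lra.
have : sin (x / 2) ^+ 2 <= (x / 2) ^+ 2 by rewrite lerXn2r ?nnegrE// sin_le_id.
by rewrite expr_div_n => h; lra.
Qed.

Section geodesic.
Context (R : realType) (m : nat).
Implicit Types x y : sphere R m.

Lemma sphere_dotp x : dotp (val x) (val x) = 1.
Proof. exact/eqP/(valP x). Qed.

Lemma sqr_distE x y : \sum_i (val x 0 i - val y 0 i) ^+ 2 =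
  2 - 2 * dotp (val x) (val y).
Proof.
transitivity (dotp (val x) (val x) + dotp (val y) (val y)
  - 2 * dotp (val x) (val y)); last by rewrite !sphere_dotp.
rewrite /dotp mulr_sumr -big_split/= -sumrB; apply: eq_bigr => i _; ring.
Qed.

Lemma dotp_sphere_bound x y : -1 <= dotp (val x) (val y) <= 1.
Proof.
apply/andP; split; last first.
  have : 0 <= \sum_i (val x 0 i - val y 0 i) ^+ 2.
    by apply: sumr_ge0 => i _; rewrite sqr_ge0.
  by rewrite sqr_distE => ?; lra.
have : 0 <= \sum_i (val x 0 i + val y 0 i) ^+ 2.
  by apply: sumr_ge0 => i _; rewrite sqr_ge0.
rewrite (_ : \sum_i _ = dotp (val x) (val x) + dotp (val y) (val y)
    + 2 * dotp (val x) (val y)).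
  by rewrite !sphere_dotp => ?; lra.
rewrite /dotp mulr_sumr -!big_split/=; apply: eq_bigr => i _; ring.
Qed.

Lemma cos_geodesic_dist x y : cos (geodesic_dist x y) = dotp (val x) (val y).
Proof. by rewrite /geodesic_dist acosK// in_itv/= dotp_sphere_bound. Qed.

Lemma geodesic_dist_ge0 x y : 0 <= geodesic_dist x y.
Proof. exact/acos_ge0/dotp_sphere_bound. Qed.

(** A chord is shorter than its arc. *)
Lemma chord_le_geodesic x y :
  \sum_i (val x 0 i - val y 0 i) ^+ 2 <= geodesic_dist x y ^+ 2.
Proof.
rewrite sqr_distE -cos_geodesic_dist onesubcos_le// geodesic_dist_ge0/=.
exact/acos_lepi/dotp_sphere_bound.
Qed.

Lemma sum_sqr_coord x : \sum_(i < m) val x 0 (lift ord0 i) ^+ 2 <= 1.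
Proof.
apply: (@le_trans _ _ (dotp (val x) (val x))); last by rewrite sphere_dotp.
rewrite /dotp big_ord_recl/= -expr2.
rewrite ler_wpDl ?sqr_ge0//; apply: ler_sum => i _; by rewrite expr2.
Qed.

Lemma coord_le1 x i : `|val x 0 i| <= 1.
Proof.
rewrite -(@ler_sqr R) ?nnegrE// expr1n -normrX ger0_norm ?sqr_ge0//.
apply: (@le_trans _ _ (dotp (val x) (val x))); last by rewrite sphere_dotp.
rewrite /dotp (bigD1 i)//= -expr2 lerDl.
by apply: sumr_ge0 => j _; rewrite -expr2 sqr_ge0.
Qed.

End geodesic.

(** * The von Mises-Fisher laws *)

Section vMF_measure.
Context (R : realType) (m : nat) (beta : R) (alpha : sphere R m).
Implicit Type x : sphere R m.

Let lin x : R := beta * dotp (val x) (val alpha).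

Let mlin : measurable_fun setT lin.
Proof. by apply: measurable_funM => //; exact: measurable_dotp. Qed.

Let lin_le x : `|lin x| <= `|beta|.
Proof.
rewrite normrM ler_piMr// ler_norml; exact: dotp_sphere_bound.
Qed.

Lemma integrable_exp_dotp :
  (@dvol R m).-integrable setT (EFin \o (fun x => expR (lin x))).
Proof.
apply: (@bounded_integrable _ _ _ _ _ (expR `|beta|)) => [|x].
  exact: measurableT_comp mlin.
by rewrite gtr0_norm ?expR_gt0// ler_expR (le_trans (ler_norm _)).
Qed.

Lemma f_vMFE x : f_vMF beta alpha x =
  (\int[@dvol R m]_y expR (lin y))^-1 * expR (lin x).
Proof.
rewrite /f_vMF cos_geodesic_dist; congr (_^-1 * _).
rewrite /Z_vMF /Rintegral; congr fine; apply: eq_integral => y _.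
by rewrite cos_geodesic_dist.
Qed.

Lemma vMFE A : vMF beta alpha A = (\int[@dvol R m]_(x in A)
  ((\int[@dvol R m]_y expR (lin y))^-1 * expR (lin x))%:E)%E.
Proof. by apply: eq_integral => x _; rewrite f_vMFE. Qed.

Let f_vMF_ge0 x : 0 <= f_vMF beta alpha x.
Proof.
rewrite f_vMFE mulr_ge0 ?expR_ge0// invr_ge0.
by apply: Rintegral_ge0 => y _; exact: expR_ge0.
Qed.

Let mf_vMF : measurable_fun setT (f_vMF beta alpha).
Proof.
rewrite (_ : f_vMF beta alpha = fun x => (\int[@dvol R m]_y expR (lin y))^-1 *
  expR (lin x)); last by apply/funext => x; exact: f_vMFE.
by apply: measurable_funM => //; exact: measurableT_comp mlin.
Qed.

Let vMF0 : vMF beta alpha set0 = 0%E.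
Proof. exact: integral_set0. Qed.

Let vMF_ge0 A : (0 <= vMF beta alpha A)%E.
Proof. by apply: integral_ge0 => x _; rewrite lee_fin. Qed.

Let vMF_sigma_additive : semi_sigma_additive (vMF beta alpha).
Proof.
apply: semi_sigma_additive_nng_induced; first exact/measurable_EFinP.
by move=> x; rewrite lee_fin.
Qed.

HB.instance Definition _ := isMeasure.Build _ _ _ (vMF beta alpha)
  vMF0 vMF_ge0 vMF_sigma_additive.

Let vMF_fin_num : fin_num_fun (vMF beta alpha).
Proof.
move=> A mA; rewrite ge0_fin_numE//.
apply: (@le_lt_trans _ _ (vMF beta alpha setT)); first by rewrite le_measure ?inE.
rewrite vMFE EFin_Rintegral ?ltry//.
exact: (integrableZl measurableT _ integrable_exp_dotp).
Qed.

HB.instance Definition _ := Measure_isFinite.Build _ _ _ (vMF beta alpha)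
  vMF_fin_num.

End vMF_measure.

(** * A hypercube of directions *)

Section hypercube.
Context (R : realType) (m : nat) (beta delta : R).
Hypothesis m_gt0 : (0 < m)%N.
Hypothesis beta_gt0 : 0 < beta.
Hypothesis delta_ge0 : 0 <= delta.
Hypothesis delta_sphere : m%:R * delta ^+ 2 <= 1.
Hypothesis delta_small : beta * delta <= 2^-1.
Implicit Types (v : {ffun 'I_m -> bool}) (x : sphere R m) (i : 'I_m).
Local Notation mu := (@dvol R m).

(** Assouad's family: directions near the pole whose m tangential coordinates are
    [delta] up to independent signs; the first coordinate restores norm 1. *)
Definition cube_vec v : 'rV[R]_m.+1 :=
  \row_k if unlift ord0 k is Some j then (-1) ^+ v j * delta
         else Num.sqrt (1 - m%:R * delta ^+ 2).

Let cube_vec_sphere v : dotp (cube_vec v) (cube_vec v) == 1.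
Proof.
rewrite /dotp big_ord_recl !mxE unlift_none -expr2 sqr_sqrtr ?subr_ge0//.
under eq_bigr do rewrite !mxE liftK -expr2 exprMn sqrr_sign mul1r.
by rewrite sumr_const card_ord mulr_natl subrK.
Qed.

Definition cube_point v : sphere R m := exist _ (cube_vec v) (cube_vec_sphere v).

Definition flip i v : {ffun 'I_m -> bool} :=
  [ffun j => if j == i then ~~ v j else v j].

Lemma flipK i : involutive (flip i).
Proof.
move=> v; apply/ffunP => j; rewrite !ffunE; case: eqP => // _.
by rewrite negbK.
Qed.

Lemma dotp_flip x v i :
  dotp (val x) (cube_vec v) - dotp (val x) (cube_vec (flip i v)) =
  2 * ((-1) ^+ v i * delta * val x 0 (lift ord0 i)).
Proof.
rewrite /dotp -sumrB big_ord_recl !mxE unlift_none subrr add0r.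
rewrite (bigD1 i)//= big1 ?addr0 => [|j ji]; rewrite !mxE liftK ffunE.
  by rewrite eqxx signrN; ring.
by rewrite (negbTE ji) subrr.
Qed.

Let coord_tilt i x : R := beta * delta * val x 0 (lift ord0 i).

Definition coord_cost i : R := tilt_cost mu (coord_tilt i) beta.

(** The squared tangential coordinates of a point of the sphere sum to at most 1,
    hence so do their means: on average over [i] the cost of a sign flip is of
    order [(beta * delta) ^+ 2 / m]. This factor [1 / m] is the source of the
    linear dependence on the dimension. *)
Lemma sum_coord_cost : \sum_i coord_cost i <= 2 * expR beta ^+ 2 * (beta * delta) ^+ 2.
Proof.
have vol_gt0 : 0 < fine (mu setT).
  by rewrite fine_gt0// dvol_gt0/= -ge0_fin_numE// fin_num_measure.
rewrite /coord_cost /tilt_cost -mulr_suml -mulr_sumr ler_pdivrMr//.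
rewrite -[leRHS]mulrA ler_pM2l ?mulr_gt0 ?exprn_gt0 ?expR_gt0//.
have mc i : measurable_fun setT (fun x => coord_tilt i x ^+ 2).
  by apply/measurable_funX/measurable_funM => //; exact: measurable_coord.
have bc i x : `|coord_tilt i x ^+ 2| <= (beta * delta) ^+ 2.
  rewrite ger0_norm ?sqr_ge0// exprMn ler_piMr ?sqr_ge0//.
  by rewrite -[leLHS]real_normK ?num_real// exprn_ile1// coord_le1.
rewrite -lee_fin -sumEFin.
under eq_bigr => i _.
  rewrite -(EFin_Rintegral (bounded_integrable mu (mc i) (bc i))).
  over.
rewrite -ge0_integral_sum//; last 2 first.
- by move=> i; apply/measurable_EFinP.
- by move=> i x _; rewrite lee_fin sqr_ge0.
apply: (@le_trans _ _ (\int[mu]_x ((beta * delta) ^+ 2)%:E)%E).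
  apply: integral_mono => x.
    by apply: sume_ge0 => i _; rewrite lee_fin sqr_ge0.
  rewrite sumEFin lee_fin /coord_tilt.
  under eq_bigr do rewrite exprMn.
  by rewrite -mulr_sumr ler_piMr ?sqr_ge0// sum_sqr_coord.
rewrite integral_cst// [leRHS]EFinM fineK//; exact: fin_num_measure.
Qed.

(** Neighbouring vertices differ by a tilt: with [a] the exponent at the midpoint,
    the exponents at [v] and [flip i v] are [a + t] and [a - t], where [t] only
    involves the i-th tangential coordinate. *)
Lemma two_point_error_flip v i n (E : set (n.-tuple (sphere R m))) : measurable E ->
  (((1 - 2 * n%:R * coord_cost i) / 2)%:E <=
   tuple_measure (vMF beta (cube_point v)) n E +
   tuple_measure (vMF beta (cube_point (flip i v))) n (~` E))%E.
Proof.
move=> mE.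
pose l v x := beta * dotp (val x) (cube_vec v).
pose a x := (l v x + l (flip i v) x) / 2.
pose t x := (l v x - l (flip i v) x) / 2.
have ml w : measurable_fun setT (l w).
  by apply: measurable_funM => //; exact: measurable_dotp.
have ma : measurable_fun setT a.
  by apply: measurable_funM => //; exact: measurable_funD.
have mt : measurable_fun setT t.
  by apply: measurable_funM => //; exact: measurable_funB.
have tE x : t x = (-1) ^+ v i * coord_tilt i x.
  by rewrite /t /l -mulrBr dotp_flip /coord_tilt; field.
have lb w x : `|l w x| <= beta.
  rewrite /l normrM gtr0_norm// ler_piMr ?(ltW beta_gt0)// ler_norml.
  exact: (dotp_sphere_bound x (cube_point w)).
have aB x : `|a x| <= beta.
  rewrite /a normrM (@ger0_norm _ 2^-1) ?invr_ge0// ler_pdivrMr//.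
  by rewrite (le_trans (ler_normD _ _))// mulr_natr mulr2n lerD.
have t2 x : `|t x| <= 2^-1.
  rewrite tE normrM normr_sign mul1r /coord_tilt normrM.
  rewrite (le_trans _ delta_small)//.
  rewrite ger0_norm ?mulr_ge0 ?(ltW beta_gt0)//.
  by rewrite ler_piMr ?mulr_ge0 ?(ltW beta_gt0)// coord_le1.
have vMF_tilt w (F : sphere R m -> R) : (forall x, F x = l w x) -> forall A,
    vMF beta (cube_point w) A =
    (\int[mu]_(x in A) ((\int[mu]_y expR (F y))^-1 * expR (F x))%:E)%E.
  by move=> /funext -> A; exact: vMFE.
have -> : coord_cost i = tilt_cost mu t beta.
  rewrite /coord_cost /tilt_cost; congr (_ * _ / _).
  by apply: eq_Rintegral => x _; rewrite tE [RHS]exprMn sqrr_sign mul1r.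
apply: (two_point_error_tilt (dvol_gt0 R m) ma mt aB t2) => // A mA.
- by apply: vMF_tilt => x; rewrite /a /t; field.
- by apply: vMF_tilt => x; rewrite /a /t; field.
Qed.

Section estimator.
Variables (n : nat) (ahat : n.-tuple (sphere R m) -> sphere R m).
Hypothesis mahat : measurable_fun setT ahat.
Local Notation law v := (tuple_measure (vMF beta (cube_point v)) n).

Definition sign_error i (b : bool) : set (n.-tuple (sphere R m)) :=
  let N := [set s | val (ahat s) 0 (lift ord0 i) < 0] in if b then ~` N else N.

Lemma measurable_sign_error i b : measurable (sign_error i b).
Proof.
have mN : measurable [set s | val (ahat s) 0 (lift ord0 i) < 0].
  have mf := measurableT_comp (@measurable_coord R m (lift ord0 i)) mahat.
  rewrite (_ : [set _ | _] = setT `&`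
    ((fun s => val (ahat s) 0 (lift ord0 i)) @^-1` `]-oo, 0[%classic)).
    exact: mf.
  by rewrite setTI; apply/seteqP; split => s /=; rewrite in_itv.
by rewrite /sign_error; case: b => //; exact: measurableC.
Qed.

Lemma sign_errorN i b : sign_error i (~~ b) = ~` sign_error i b.
Proof. by rewrite /sign_error; case: b => //=; rewrite setCK. Qed.

(** The loss dominates the chord, each wrong sign costs at least [delta ^+ 2] in
    the squared chord, and the square root of the number [H <= m] of wrong signs
    is at least [H / sqrt m]. The bound is now additive over coordinates. *)
Lemma sign_error_loss v s :
  delta / Num.sqrt m%:R * \sum_i \1_(sign_error i (v i)) s <=
  geodesic_dist (ahat s) (cube_point v).
Proof.
set H := \sum_i _.
have m0 : 0 < m%:R :> R by rewrite ltr0n.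
have H0 : 0 <= H by apply: sumr_ge0.
have Hm : H <= m%:R.
  rewrite -[m in m%:R]card_ord -sum1_card natr_sum ler_sum// => i _.
  by rewrite indicE lern1; case: (_ \in _).
rewrite -(@ler_sqr R) ?nnegrE ?geodesic_dist_ge0//; last first.
  by rewrite mulr_ge0// divr_ge0.
apply: le_trans (chord_le_geodesic _ _).
rewrite big_ord_recl/= ler_wpDl ?sqr_ge0//.
apply: (@le_trans _ _ (delta ^+ 2 * H)).
  rewrite exprMn expr_div_n sqr_sqrtr ?(ltW m0)// -mulrA ler_wpM2l ?sqr_ge0//.
  by rewrite mulrC ler_pdivrMr// expr2 ler_wpM2l.
rewrite mulr_sumr; apply: ler_sum => i _.
rewrite indicE; case: (boolP (s \in _)) => [|_]; last by rewrite mulr0 sqr_ge0.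
rewrite inE mulr1 mxE liftK /sign_error.
case: (v i) => /=.
  move=> /negP; rewrite -leNgt expr1 mulN1r opprK => y0.
  by rewrite ler_sqr ?nnegrE ?addr_ge0// lerDr.
move=> y0; rewrite expr0 mul1r -[leRHS]sqrrN opprB.
by rewrite ler_sqr ?nnegrE ?subr_ge0 ?(le_trans (ltW y0))// lerBrDl gerDr ltW.
Qed.

Lemma expected_loss_sign_error v :
  (\sum_i (delta / Num.sqrt m%:R)%:E * law v (sign_error i (v i)) <=
   expected_loss beta ahat (cube_point v))%E.
Proof.
have c0 : 0 <= delta / Num.sqrt m%:R by rewrite divr_ge0.
under eq_bigr => i _.
  rewrite -[X in law v X]setIT -(integral_indic (law v))//; last first.
    exact: measurable_sign_error.
  rewrite -ge0_integralZl//; last first.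
    by apply/measurable_EFinP; apply: measurable_indic; exact: measurable_sign_error.
  over.
rewrite -ge0_integral_sum//; last 2 first.
- move=> i; apply: emeasurable_funM; first exact: measurable_cst.
  by apply/measurable_EFinP; apply: measurable_indic; exact: measurable_sign_error.
- by move=> i s _; rewrite mule_ge0 ?lee_fin.
apply: integral_mono => s.
  by apply: sume_ge0 => i _; rewrite mule_ge0 ?lee_fin.
under eq_bigr do rewrite -EFinM.
by rewrite sumEFin lee_fin -mulr_sumr sign_error_loss.
Qed.

(** Pairing every vertex with its i-th neighbour turns the errors on coordinate
    [i] into a family of two-point testing problems. *)
Lemma sum_sign_error i :
  ((2 ^+ m * (1 - 2 * n%:R * coord_cost i) / 4)%:E <=
   \sum_v law v (sign_error i (v i)))%E.
Proof.
set X := (\sum_v _)%E.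
have XE : X = (\sum_v law (flip i v) (~` sign_error i (v i)))%E.
  rewrite /X (reindex_inj (inv_inj (flipK i)))/=; apply: eq_bigr => v _.
  by rewrite ffunE eqxx sign_errorN.
have : ((2 ^+ m * ((1 - 2 * n%:R * coord_cost i) / 2))%:E <= X + X)%E.
  rewrite {2}XE /X -big_split/=.
  rewrite (_ : (_ * _)%:E = \sum_(v : {ffun 'I_m -> bool})
      ((1 - 2 * n%:R * coord_cost i) / 2)%:E)%E.
    by apply: lee_sum => v _; apply: two_point_error_flip; exact: measurable_sign_error.
  rewrite sumEFin; congr EFin.
  by rewrite sumr_const card_ffun card_bool card_ord -[RHS]mulr_natl natrX.
have : (0 <= X)%E by rewrite /X; apply: sume_ge0 => v _; exact: measure_ge0.
case: X {XE} => [r| |] //= _; last by move=> _; rewrite leey.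
by rewrite -EFinD !lee_fin => h; lra.
Qed.

Hypothesis delta_n :
  4 * n%:R * expR beta ^+ 2 * (beta * delta) ^+ 2 <= m%:R / 2.

(** The supremum is at least the average over the vertices. *)
Lemma sup_risk_cube :
  ((delta * Num.sqrt m%:R / 8)%:E <=
   ereal_sup (range (expected_loss beta ahat)))%E.
Proof.
set S := ereal_sup _; set c := delta / Num.sqrt m%:R.
have m0 : 0 < m%:R :> R by rewrite ltr0n.
have c0 : 0 <= c by rewrite divr_ge0.
have LS v : (\sum_i c%:E * law v (sign_error i (v i)) <= S)%E.
  apply: (le_trans (expected_loss_sign_error v)).
  by apply: ereal_sup_ubound; exists (cube_point v).
have : ((2 ^+ m * (delta * Num.sqrt m%:R / 8))%:E <=
    \sum_(v : {ffun 'I_m -> bool}) S)%E.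
  apply: (@le_trans _ _ (\sum_v \sum_i c%:E * law v (sign_error i (v i)))%E);
    last by apply: lee_sum => v _; exact: LS.
  rewrite exchange_big/=.
  under eq_bigr do rewrite -ge0_sume_distrr//.
  apply: (@le_trans _ _ (\sum_i c%:E *
      (2 ^+ m * (1 - 2 * n%:R * coord_cost i) / 4)%:E)%E); last first.
    apply: lee_sum => i _; rewrite lee_wpmul2l ?lee_fin//.
    exact: sum_sign_error.
  under eq_bigr do rewrite -EFinM.
  rewrite sumEFin lee_fin -mulr_sumr -mulr_suml -mulr_sumr sumrB sumr_const.
  rewrite card_ord -mulr_sumr.
  have -> : delta * Num.sqrt m%:R / 8 = c * (m%:R / 2 / 4).
    rewrite /c -[in m%:R / 2](@sqr_sqrtr _ m%:R) ?ltW//.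
    by field; rewrite sqrtr_eq0 -ltNge.
  rewrite mulrCA ler_wpM2l// -[leRHS]mulrA ler_pM2l ?exprn_gt0// ler_pM2r ?invr_gt0//.
  have : 2 * n%:R * \sum_i coord_cost i <=
      2 * n%:R * (2 * expR beta ^+ 2 * (beta * delta) ^+ 2).
    by rewrite ler_wpM2l ?mulr_ge0// sum_coord_cost.
  by move: delta_n => h1 h2; lra.
have : (0 <= S)%E.
  by apply: le_trans (LS [ffun=> false]); apply: sume_ge0 => i _; rewrite mule_ge0.
case: S {LS} => [r| |] //= _; last by move=> _; rewrite leey.
rewrite sumEFin sumr_const card_ffun card_bool card_ord -[r *+ _]mulr_natl natrX.
by rewrite !lee_fin ler_pM2l ?exprn_gt0.
Qed.

End estimator.

Lemma minimax_risk_cube n :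
  4 * n%:R * expR beta ^+ 2 * (beta * delta) ^+ 2 <= m%:R / 2 ->
  ((delta * Num.sqrt m%:R / 8)%:E <= minimax_risk m beta n)%E.
Proof.
move=> dn; apply: le_ereal_inf_tmp => _ [ahat mahat <-].
exact: sup_risk_cube.
Qed.

End hypercube.

Theorem theorem7p5 (R : realType) (beta : R) (hbeta : 0 < beta) :
  exists2 C : R, 0 < C &
    forall m : nat, (0 < m)%N ->
      exists n0 : nat, forall n : nat, (n0 <= n)%N ->
        ((C * m%:R / Num.sqrt n%:R)%:E <= minimax_risk m beta n)%E.
Proof.
have e0 : 0 < expR beta := expR_gt0 beta.
(* 24 = 8 * 3: the factor 8 of minimax_risk_cube and the factor 3 in delta *)
exists (24 * beta * expR beta)^-1; first by rewrite invr_gt0 !mulr_gt0.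
move=> m m_gt0; pose x := m%:R ^+ 2 / (beta * expR beta) ^+ 2.
exists (Num.truncn x + m).+1 => n hn.
have m0 : 0 < m%:R :> R by rewrite ltr0n.
have n0 : 0 < n%:R :> R by rewrite ltr0n (leq_trans _ hn).
have xn : x <= n%:R.
  rewrite (le_trans (ltW (truncnS_gt x)))// ler_nat (leq_trans _ hn)//.
  by rewrite ltnS leq_addr.
have mn : m%:R <= n%:R :> R.
  by rewrite ler_nat (leq_trans _ hn)// ltnW// ltnS leq_addl.
have sn0 : 0 < Num.sqrt n%:R :> R by rewrite sqrtr_gt0.
(* the largest order of magnitude, sqrt (m / n), for which sum_coord_cost keeps
   the average of 2 * n * coord_cost i over the coordinates below 1/2 *)
pose delta := Num.sqrt m%:R / (3 * beta * expR beta * Num.sqrt n%:R).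
have bd2 : (beta * delta) ^+ 2 = m%:R / (9 * expR beta ^+ 2 * n%:R).
  rewrite exprMn expr_div_n sqr_sqrtr ?ltW//.
  rewrite -[in RHS](@sqr_sqrtr _ n%:R) ?ltW//.
  by field; rewrite !gt_eqF.
have delta0 : 0 <= delta by rewrite divr_ge0// !mulr_ge0 ?ltW.
have -> : (24 * beta * expR beta)^-1 * m%:R / Num.sqrt n%:R =
    delta * Num.sqrt m%:R / 8.
  rewrite /delta -[in LHS](@sqr_sqrtr _ m%:R) ?ltW//.
  by field; rewrite !gt_eqF.
have e1 : 1 <= expR beta ^+ 2.
  by rewrite exprn_ege1// (le_trans _ (expR_ge1Dx beta))// lerDl ltW.
apply: minimax_risk_cube => //.
- have -> : m%:R * delta ^+ 2 = x / n%:R / 9.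
    rewrite /x expr_div_n sqr_sqrtr ?ltW//.
    rewrite -[in RHS](@sqr_sqrtr _ n%:R) ?ltW//.
    by field; rewrite !gt_eqF.
  rewrite ler_pdivrMr// mul1r ler_pdivrMr// (le_trans xn)//.
  lra.
- have bd0 : 0 <= beta * delta by rewrite mulr_ge0 ?(ltW hbeta).
  have : (beta * delta) ^+ 2 <= 2^-1 ^+ 2.
    rewrite bd2 ler_pdivrMr ?mulr_gt0 ?exprn_gt0//.
    have : n%:R <= expR beta ^+ 2 * n%:R by rewrite ler_peMl ?(ltW n0).
    by move=> h; lra.
  by rewrite ler_sqr// nnegrE.
- rewrite bd2 [leLHS](_ : _ = 4 / 9 * m%:R); last by field; rewrite !gt_eqF.
  by lra.
Qed.
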